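(* Let $f$ be a decomposable uniform CN function with CN form $f=[g:g_1,\dots,g_r]$ and decomposition $((\bm x_1,\bm y_1),\dots,(\bm x_p,\bm y_p))$ of $(\bm x,\bm y)$, and let $(\bm x^*,\bm y^* )=((\bm x_1^*,\bm y_1^* ),\dots,(\bm x_p^*,\bm y_p^* ))\in X(f)$. For each $j=1,\dots,p$ consider the problem $$(\mathrm{UCNP})_j(\bm x_j^*,\bm y_j^* ):\quad\min\ \nabla_jg(\bm x^*,\bm y^* )^\top\bm d_j+\tfrac{\bar\rho}{2}\|\bm d_j\|^2\quad\text{s.t. }\bm d_j\in T_j(\bm x_j^*,\bm y_j^* ).$$ If for all $j=1,\dots,p$, $\bm d_j^*$ is an optimal solution to $(\mathrm{UCNP})_j(\bm x_j^*,\bm y_j^* )$ such that $\nabla_jg(\bm x^*,\bm y^* )^\top\bm d_j^*+\frac{\bar\rho}{2}\|\bm d_j^*\|^2\ge0$, then $(\bm x^*,\bm y^* )$ is an optimal solution to (CNP) and $\bm x^*$ is an optimal solution to (CNO). Furthermore, if there is a $\bm d'$ such that $\nabla g_i(\bm x^*,\bm y^* )^\top\bm d'<0$, $i=1,\dots,r$, then there are $\alpha_i^*\ge0$, $i=1,\dots,r$, such that $$\bar\rho\,\bm d^*+\nabla g(\bm x^*,\bm y^* )+\sum_{i=1}^r\alpha_i^*\nabla g_i(\bm x^*,\bm y^* )=0,\qquad \bm d^*=(\bm d_1^*,\dots,\bm d_p^* ).$$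
   Context: Let $f:\mathbb{R}^n\to\mathbb{R}$ be nonconvex and let $g,g_1,\dots,g_r:\mathbb{R}^n\times\mathbb{R}^m\to\mathbb{R}$ ($r\ge1$) be convex and twice differentiable. Put $X(\bm g)=\{(\bm x,\bm y): g_i(\bm x,\bm y)=0,\ i=1,\dots,r\}$. $f$ is a CN (convertible nonconvex) function with CN form $f=[g:g_1,\dots,g_r]$ if for each $\bm x\in\mathbb{R}^n$ there is $\bm y\in\mathbb{R}^m$ with $(\bm x,\bm y)\in X(\bm g)$ and $f(\bm x)=g(\bm x,\bm y)=\min_{(\bm x,\bm y')\in X(\bm g)}g(\bm x,\bm y')$. It is a uniform CN function if moreover $g$ is uniform convex: there is $\bar\rho>0$ (fixed) with $g((\bm x,\bm y)+\bm d)-g(\bm x,\bm y)\ge\nabla g(\bm x,\bm y)^\top\bm d+\frac{\bar\rho}{2}\|\bm d\|^2$ for all $(\bm x,\bm y),\bm d\in\mathbb{R}^n\times\mathbb{R}^m$. $X(f)=\{(\bm x,\bm y)\in X(\bm g): f(\bm x)=g(\bm x,\bm y)\}$. (CNO): $\min f(\bm x)$ s.t. $\bm x\in\mathbb{R}^n$. (CNP): $\min g(\bm x,\bm y)$ s.t. $g_i(\bm x,\bm y)=0$, $i=1,\dots,r$. ''Optimal solution'' means global minimizer. Decomposition: the variables of $(\bm x,\bm y)\in\mathbb{R}^n\times\mathbb{R}^m$ are rearranged into $p$ blocks ($2\le p\le\min\{n,m\}$) $((\bm x_1,\bm y_1),\dots,(\bm x_p,\bm y_p))$, $\bm x_j\in\mathbb{R}^{p_j}$,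 $\bm y_j\in\mathbb{R}^{q_j}$, $\sum_jp_j=n$, $\sum_jq_j=m$, with no variable common to two blocks (vectors such as gradients and $\bm d$ are arranged in blocks accordingly). $f$ is decomposable if each of $g_1,\dots,g_r$ depends on the variables of one block only, so that the constraints can be written $\bm g(\bm x,\bm y)=(\bm g_1(\bm x_1,\bm y_1),\dots,\bm g_p(\bm x_p,\bm y_p))=0$. $\nabla_j$ denotes the gradient with respect to the block $(\bm x_j,\bm y_j)$, the other blocks being fixed. $T_j(\bm x_j,\bm y_j)=\{\bm d_j\in\mathbb{R}^{p_j}\times\mathbb{R}^{q_j}:\nabla_jg_i(\bm x,\bm y)^\top\bm d_j\le0,\ i=1,\dots,r\}$. *)

(* Defs.v *)
From HB Require Import structures.
From mathcomp Require Import all_boot all_order all_algebra.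
From mathcomp Require Import all_classical all_reals all_analysis.
Set Implicit Arguments.
Unset Strict Implicit.
Unset Printing Implicit Defensive.
Import Order.TTheory GRing.Theory Num.Theory.
Import numFieldNormedType.Exports.
Local Open Scope classical_set_scope.
Local Open Scope ring_scope.

Section Euclidean.
Variables (R : realType) (n m : nat).
Local Notation E := ('rV[R]_n * 'rV[R]_m)%type.

Definition dot (z w : E) : R :=
  \sum_i z.1 0 i * w.1 0 i + \sum_i z.2 0 i * w.2 0 i.

(* The library norm on E is the sup norm, hence a separate Euclidean norm.
   Differentiability does not depend on this choice. *)
Definition enorm (z : E) : R := Num.sqrt (dot z z).

Definition grad (h : E -> R) (z : E) : E :=
  (\row_i 'D_((delta_mx 0 i, 0) : E) h z,
   \row_i 'D_((0, delta_mx 0 i) : E) h z).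

Definition twice_differentiable (h : E -> R) : Prop :=
  (forall z, differentiable h z) /\ (forall z, differentiable (grad h) z).

Definition uniform_convex (rho : R) (h : E -> R) : Prop :=
  0 < rho /\
  forall z d : E,
    h (z + d) - h z >= dot (grad h z) d + rho / 2 * enorm d ^+ 2.

End Euclidean.

(* Global minimizer of F over S *)
Definition optimal_solution (R : realType) (T : Type) (F : T -> R) (S : set T)
    (x : T) : Prop :=
  S x /\ forall y, S y -> F x <= F y.

Section ConvertibleNonconvex.
Variables (R : realType) (n m r : nat).
Local Notation E := ('rV[R]_n * 'rV[R]_m)%type.

Definition Xg (gs : 'I_r -> E -> R) : set E :=
  [set z | forall i, gs i z = 0].

Definition Xf (f : 'rV[R]_n -> R) (g : E -> R) (gs : 'I_r -> E -> R) : set E :=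
  [set z | Xg gs z /\ f z.1 = g z].

Record CN_form (f : 'rV[R]_n -> R) (g : E -> R) (gs : 'I_r -> E -> R) : Prop :=
  { CN_constraints : (1 <= r)%N;
    CN_nonconvex : ~ convex_function [set: 'rV[R]_n] f;
    CN_obj_convex : convex_function [set: E] g;
    CN_obj_diff : twice_differentiable g;
    CN_cstr_convex : forall i, convex_function [set: E] (gs i);
    CN_cstr_diff : forall i, twice_differentiable (gs i);
    CN_min : forall x, exists y,
      optimal_solution (fun y' => g (x, y')) [set y' | Xg gs (x, y')] y
      /\ f x = g (x, y) }.

Definition uniform_CN_form (rho : R) (f : 'rV[R]_n -> R) (g : E -> R)
    (gs : 'I_r -> E -> R) : Prop :=
  CN_form f g gs /\ uniform_convex rho g.

End ConvertibleNonconvex.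

(* xvar j k is the position in x of the k-th coordinate of the block x_j, and
   likewise for y.  Bijectivity says that the blocks rearrange all variables,
   none being shared by two blocks; it forces \sum_j xdim j = n and
   \sum_j ydim j = m. *)
Record decomposition (n m p : nat) := Decomposition {
  xdim : 'I_p -> nat;
  ydim : 'I_p -> nat;
  xvar : forall j, 'I_(xdim j) -> 'I_n;
  yvar : forall j, 'I_(ydim j) -> 'I_m;
  xvar_bij : bijective (fun s : {j : 'I_p & 'I_(xdim j)} => xvar (tagged s));
  yvar_bij : bijective (fun s : {j : 'I_p & 'I_(ydim j)} => yvar (tagged s));
  nblocks_gt1 : (2 <= p)%N;
  nblocks_le : (p <= minn n m)%N }.

Section Blocks.
Variables (R : realType) (n m p : nat) (D : decomposition n m p).
Local Notation E := ('rV[R]_n * 'rV[R]_m)%type.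
Local Notation Eb j := ('rV[R]_(xdim D j) * 'rV[R]_(ydim D j))%type.

Definition block (j : 'I_p) (z : E) : Eb j :=
  (\row_k z.1 0 (xvar k), \row_k z.2 0 (yvar k)).

(* z with its j-th block replaced by u *)
Definition set_block (j : 'I_p) (u : Eb j) (z : E) : E :=
  (\row_i if [pick k | xvar k == i] is Some k then u.1 0 k else z.1 0 i,
   \row_i if [pick k | yvar k == i] is Some k then u.2 0 k else z.2 0 i).

(* (d_1, ..., d_p) as a vector in the original ordering of the variables *)
Definition of_blocks (d : forall j, Eb j) : E :=
  \sum_j set_block (d j) 0.

Definition decomposable (r : nat) (gs : 'I_r -> E -> R) : Prop :=
  forall i, exists j, forall z z' : E, block j z = block j z' -> gs i z = gs i z'.

Definition block_grad (j : 'I_p) (h : E -> R) (z : E) : Eb j :=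
  grad (fun u : Eb j => h (set_block u z)) (block j z).

(* If gs is decomposable, this depends on z only through its j-th block. *)
Definition Tcone (r : nat) (gs : 'I_r -> E -> R) (j : 'I_p) (z : E) : set (Eb j) :=
  [set d | forall i, dot (block_grad j (gs i) z) d <= 0].

Definition UCNP_obj (rho : R) (g : E -> R) (j : 'I_p) (z : E) (d : Eb j) : R :=
  dot (block_grad j g z) d + rho / 2 * enorm d ^+ 2.

End Blocks.

(* Main.v *)
Require Import Defs.
From HB Require Import structures.
From mathcomp Require Import all_boot all_order all_algebra.
From mathcomp Require Import all_classical all_reals all_analysis.
From mathcomp Require Import ring lra.
Import Order.TTheory GRing.Theory Num.Theory.
Import numFieldNormedType.Exports.

(** Write [zs] for the given point and [z] for a feasible point of (CNP), and put
[d := z - zs].  Convexity gives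
[0 = gs i z - gs i zs >= dot (grad (gs i) zs) d], so [d] lies in the linearized
cone [T] of all [d] with [dot (grad (gs i) zs) d <= 0] for every [i], and uniform
convexity gives
[g z - g zs >= Q d] with [Q d := dot (grad g zs) d + rho / 2 * enorm d ^+ 2].
Global optimality of [zs] thus follows from [Q >= 0] on [T].

The role of decomposability is to split the minimization of [Q] over [T] into
the given blockwise problems.  The objective [Q] is always the sum of the block
objectives (lemma [UCNP_obj_sum]).  The gradient of a constraint that depends on
a single block vanishes outside that block, so [T] is the product of the block
cones (lemma [Tcone_blocks]).  Hence [Q d] is bounded below by the sum of
the block minima, which are nonnegative, and [of_blocks ds] minimizes [Q] on [T].

The multipliers come from this last fact alone, by way of Farkas' lemma: at the
minimizer [u] of the quadratic [Q] on the polyhedral cone [T], the gradient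
[rho *: u + grad g zs] is nonnegative on [T], so its opposite is a
nonnegative combination of the normals [grad (gs i) zs]
(lemma [cone_quadratic_kkt]). *)

Set Implicit Arguments.
Unset Strict Implicit.
Unset Printing Implicit Defensive.
Local Open Scope classical_set_scope.
Local Open Scope ring_scope.

(** * Farkas' lemma *)

Section Farkas.
Variables (R : realFieldType) (V : lmodType R).

(** Induction on the number of functionals.  If the first one, [a ord0], cannot
be dropped from the premise, some [x] satisfies all the other inequalities with
[b x > 0], and then [a ord0 x > 0].  Projecting [V] along [x] onto the
kernel of [a ord0] eliminates [a ord0]; the multiplier of [a ord0] is the one that
makes the resulting identity hold at [x], and its sign is that of [b x]
minus a sum of nonpositive terms. *)
Lemma farkas (r : nat) (a : 'I_r -> V -> R) (b : V -> R) :
  (forall i, scalar (a i)) -> scalar b ->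
  (forall x, (forall i, a i x <= 0) -> b x <= 0) ->
  exists2 lam : 'I_r -> R, (forall i, 0 <= lam i) &
    forall x, b x = \sum_i lam i * a i x.
Proof.
elim: r a b => [|r IHr] a b lin_a lin_b imp_ab.
  exists (fun=> 0) => // x; rewrite big_ord0.
  have bN y : b (- y) = - b y.
    have b0 : b 0 = 0 by move: (lin_b (-1) 0 0); rewrite scaler0 addr0; lra.
    by rewrite -[- y]addr0 -scaleN1r lin_b b0; lra.
  have : b x <= 0 by apply: imp_ab => -[].
  have : b (- x) <= 0 by apply: imp_ab => -[].
  by rewrite bN; lra.
have [imp_ab' | ] := pselect (forall x, (forall i, a (lift ord0 i) x <= 0) ->
    b x <= 0).
  have [lam lam_ge0 bE] := IHr _ _ (fun i => lin_a (lift ord0 i)) lin_b imp_ab'.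
  exists (fun i => oapp lam 0 (unlift ord0 i)) => [i|x].
    by case: unliftP => [j|] /=.
  rewrite big_ord_recl unlift_none /= mul0r add0r bE.
  by apply: eq_bigr => i _; rewrite liftK.
move=> /existsNP[x /not_implyP[ax_le0 /negP]]; rewrite -ltNge => bx_gt0.
have a0x_gt0 : 0 < a ord0 x.
  rewrite ltNge; apply/negP => a0x_le0; have : b x <= 0; last by lra.
  apply: imp_ab => i; case: (unliftP ord0 i) => [j ->|->] //.
pose t := (a ord0 x)^-1; have t_gt0 : 0 < t by rewrite invr_gt0.
(* The projection is y |-> y - (t * a ord0 y) *: x, which a ord0 sends to 0. *)
have proj h : scalar h -> scalar (fun y => h y - t * h x * a ord0 y).
  by move=> lin_h c u v; rewrite lin_h lin_a /=; ring.
have projE (h : V -> R) y : scalar h ->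
    h (- (t * a ord0 y) *: x + y) = h y - t * h x * a ord0 y.
  by move=> lin_h; rewrite lin_h /=; ring.
have imp_proj y : (forall i, a (lift ord0 i) y - t * a (lift ord0 i) x *
    a ord0 y <= 0) -> b y - t * b x * a ord0 y <= 0.
  move=> ay_le0; rewrite -projE//; apply: imp_ab => i.
  rewrite projE//; case: (unliftP ord0 i) => [j ->|->] //.
  by rewrite /t mulVf ?gt_eqF// mul1r subrr.
have [lam lam_ge0 bE] :=
  IHr _ _ (fun i => proj _ (lin_a (lift ord0 i))) (proj _ lin_b) imp_proj.
exists (fun i => oapp lam
    (t * (b x - \sum_i lam i * a (lift ord0 i) x)) (unlift ord0 i)) => [i|y].
  case: unliftP => [j|] _ //=; rewrite mulr_ge0 1?ltW// subr_gt0.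
  apply: le_lt_trans bx_gt0; apply: sumr_le0 => j _.
  by rewrite mulr_ge0_le0.
rewrite big_ord_recl unlift_none /=.
rewrite [X in _ = _ + X](eq_bigr (fun i => lam i * a (lift ord0 i) y));
    last by move=> i _; rewrite liftK.
move: (bE y) => /eqP; rewrite subr_eq => /eqP ->.
have -> : \sum_i lam i * (a (lift ord0 i) y - t * a (lift ord0 i) x * a ord0 y)
    = \sum_i lam i * a (lift ord0 i) y -
      (\sum_i lam i * a (lift ord0 i) x) * (t * a ord0 y).
  by rewrite mulr_suml -sumrB; apply: eq_bigr => i _; ring.
ring.
Qed.

End Farkas.

(** * Euclidean inner product, gradients and convexity *)

Section Euclid.
Variables (R : realType) (n m : nat).
Local Notation E := ('rV[R]_n * 'rV[R]_m)%type.
Implicit Types (u v w : E) (a : R).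

Lemma dot_scalar u : scalar (dot u).
Proof.
move=> a v w; rewrite /dot mulrDr !mulr_sumr addrACA -!big_split /=.
by congr (_ + _); apply: eq_bigr => i _; rewrite !mxE; ring.
Qed.

Lemma dotC u v : dot u v = dot v u.
Proof. by rewrite /dot; congr (_ + _); apply: eq_bigr => i _; rewrite mulrC. Qed.

HB.instance Definition _ u :=
  GRing.isLinear.Build R E R *%R (dot u) (dot_scalar u).

Lemma dotZr u a v : dot u (a *: v) = a * dot u v.
Proof. by rewrite linearZ. Qed.

Lemma dotDl u v w : dot (u + v) w = dot u w + dot v w.
Proof. by rewrite dotC linearD /= dotC (dotC w). Qed.

Lemma dotZl u a v : dot (a *: u) v = a * dot u v.
Proof. by rewrite dotC dotZr dotC. Qed.

Lemma dot0l u : dot 0 u = 0.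
Proof. by rewrite dotC linear0. Qed.

Lemma dot_suml r (F : 'I_r -> E) u : dot (\sum_i F i) u = \sum_i dot (F i) u.
Proof. by rewrite dotC linear_sum; apply: eq_bigr => i _; rewrite dotC. Qed.

Lemma enorm_sqr u : enorm u ^+ 2 = dot u u.
Proof.
by rewrite sqr_sqrtr// addr_ge0//; apply: sumr_ge0 => i _; rewrite -expr2 sqr_ge0.
Qed.

Lemma dot_nondegenerate u : (forall v, dot u v = 0) -> u = 0.
Proof.
move=> /(_ u); rewrite /dot => /eqP.
rewrite paddr_eq0; try by apply: sumr_ge0 => i _; rewrite -expr2 sqr_ge0.
rewrite !psumr_eq0; try by move=> i _; rewrite -expr2 sqr_ge0.
case: u => u1 u2 /= /andP[/allP u1_0 /allP u2_0].
congr (_, _); apply/rowP => i; rewrite mxE; apply/eqP.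
  by have := u1_0 i (mem_index_enum _); rewrite mulf_eq0 orbb.
by have := u2_0 i (mem_index_enum _); rewrite mulf_eq0 orbb.
Qed.

Lemma derive_grad (h : E -> R) u v :
  differentiable h u -> 'D_v h u = dot (grad h u) v.
Proof.
move=> dh.
have vE : v = \sum_i v.1 0 i *: ((delta_mx 0 i, 0) : E) +
    \sum_i v.2 0 i *: ((0, delta_mx 0 i) : E).
  rewrite [LHS]surjective_pairing [RHS]surjective_pairing /=.
  rewrite !(raddf_sum (@fst _ _)) !(raddf_sum (@snd _ _)) /=; congr (_, _).
    rewrite [X in _ + X]big1 ?addr0 => [|i _]; last by rewrite scaler0.
    exact: row_sum_delta.
  rewrite [X in X + _]big1 ?add0r => [|i _]; last by rewrite scaler0.
  exact: row_sum_delta.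
rewrite deriveE// {1}vE linearD !linear_sum /dot /grad /=.
by congr (_ + _); apply: eq_bigr => i _; rewrite linearZ mxE deriveE// mulrC.
Qed.

(** The difference quotients of a convex [h] at [u] in direction [v] are bounded
by [h (u + v) - h u] for steps in ]0, 1], hence so is their limit. *)
Lemma convex_gradient (h : E -> R) u v : convex_function [set: E] h ->
  differentiable h u -> h u + dot (grad h u) v <= h (u + v).
Proof.
move=> cvx_h dh; rewrite -derive_grad// addrC -lerBrDr.
have dhv : derivable h u v by exact: diff_derivable.
rewrite /derive cvg_at_rightE//; apply: limr_le.
  by apply/cvg_ex; exists ('D_v h u); apply: cvg_dnbhs_at_right.
near=> t.
have t_gt0 : 0 < t by near: t; exact: nbhs_right_gt.
have t_le1 : t <= 1 by near: t; exact: nbhs_right_le.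
rewrite /= -[X in X <= _]/(t^-1 * _) mulrC ler_pdivrMr//.
have := cvx_h (Itv01 (ltW t_gt0) t_le1) (u + v) u; rewrite !inE.
move=> /(_ Logic.I Logic.I).
rewrite convRE /conv /= /unstable.onem.
have -> : t *: (u + v) + (1 - t) *: u = t *: v + u.
  by rewrite scalerDr scalerBl scale1r addrAC addrCA subrr addr0 addrC.
lra.
Unshelve. all: by end_near. Qed.

(** First-order condition on a convex cone: for [d] in the cone, [u + t *: d] is
feasible for every [t > 0], so the gradient [rho *: u + c] of the objective at
[u] is nonnegative on [d].  Farkas' lemma turns this into multipliers. *)
Lemma cone_quadratic_kkt (r : nat) (a : 'I_r -> E) (c u : E) (rho : R) :
  optimal_solution (fun d => dot c d + rho / 2 * enorm d ^+ 2)
    [set d | forall i, dot (a i) d <= 0] u ->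
  exists2 alpha : 'I_r -> R, (forall i, 0 <= alpha i) &
    rho *: u + c + \sum_i alpha i *: a i = 0.
Proof.
move=> [u_feas u_min].
have grad_ge0 d : (forall i, dot (a i) d <= 0) -> 0 <= dot (rho *: u + c) d.
  move=> d_feas; rewrite leNgt; apply/negP => lt0.
  (* The objective changes by - t * s + t ^+ 2 * (rho / 2 * dot d d), which is at
     most - t * s / 2 < 0 for the step t = s / (2 * q). *)
  pose s := - dot (rho *: u + c) d.
  have s_gt0 : 0 < s by rewrite oppr_gt0.
  pose q := `|rho / 2 * dot d d| + 1.
  have q_gt0 : 0 < q by rewrite ltr_wpDl.
  pose t := s / (2 * q).
  have t_gt0 : 0 < t by rewrite divr_gt0// mulr_gt0.
  have feas : forall i, dot (a i) (u + t *: d) <= 0.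
    move=> i; rewrite linearD /= dotZr.
    have := u_feas i; have := d_feas i; nra.
  have := u_min _ feas; rewrite !enorm_sqr !linearD /= !dotDl !dotZr !dotZl.
  rewrite (dotC d u) => le_min.
  have : t * (rho / 2 * dot d d) <= s / 2.
    apply: le_trans (_ : t * q <= _).
      by rewrite ler_pM2l// (le_trans (ler_norm _))// lerDl.
    by rewrite /t invfM mulrA mulrVK ?unitfE ?gt_eqF.
  have sE : s = - (rho * dot u d + dot c d) by rewrite /s dotDl dotZl.
  nra.
have lin_opp : scalar (fun d => - dot (rho *: u + c) d).
  by move=> x v w; rewrite linearP /=; ring.
have [|alpha alpha_ge0 alphaE] :=
    farkas (fun i => @dot_scalar (a i)) lin_opp.
  by move=> d /grad_ge0; rewrite oppr_le0.
exists alpha => //; apply: dot_nondegenerate => d.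
rewrite dotDl dot_suml.
under eq_bigr do rewrite dotZl.
by rewrite -alphaE subrr.
Qed.

End Euclid.

(** * Rearranging coordinates into blocks *)

Section BlockVariables.
Variables (I : finType) (dim : I -> nat) (N : nat).
Variable var : forall j, 'I_(dim j) -> 'I_N.
Hypothesis var_bij : bijective (fun s : {j : I & 'I_(dim j)} => var (tagged s)).

Lemma var_inj j : injective (@var j).
Proof.
move=> k l kl; pose T j := 'I_(dim j); apply/eqP.
have : Tagged T k == Tagged T l by apply/eqP; exact: (bij_inj var_bij).
by rewrite eq_Tagged.
Qed.

Lemma var_block j j' (k : 'I_(dim j)) (l : 'I_(dim j')) : var k = var l -> j = j'.
Proof. by move=> /(@bij_inj _ _ _ var_bij (Tagged _ k) (Tagged _ l)) []. Qed.

Lemma var_surj i : exists j, exists k : 'I_(dim j), var k = i.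
Proof.
by have [h _ hK] := var_bij; exists (tag (h i)), (tagged (h i)); exact: hK.
Qed.

Lemma pick_var j (k : 'I_(dim j)) : [pick l | @var j l == var k] = Some k.
Proof.
by case: pickP => [l /eqP/var_inj -> //|/(_ k)]; rewrite eqxx.
Qed.

Lemma pick_var_neq j j' (k : 'I_(dim j')) : j' != j ->
  [pick l | @var j l == var k] = None.
Proof.
by case: pickP => // l /eqP/var_block/esym /eqP jj' /negP.
Qed.

Lemma sum_var (R : nmodType) (F : 'I_N -> R) :
  \sum_i F i = \sum_j \sum_k F (@var j k).
Proof. by rewrite sig_big_dep (reindex _ (onW_bij _ var_bij)). Qed.

End BlockVariables.

Section Blocks.
Variables (R : realType) (n m p : nat) (D : decomposition n m p).
Local Notation E := ('rV[R]_n * 'rV[R]_m)%type.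
Local Notation Eb j := ('rV[R]_(xdim D j) * 'rV[R]_(ydim D j))%type.
Implicit Types (z w : E) (h : E -> R).

Lemma block_linear j : linear (@block R n m p D j).
Proof. by move=> a z w; congr (_, _); apply/rowP => k; rewrite !mxE. Qed.

HB.instance Definition _ j :=
  GRing.isLinear.Build R E (Eb j) *:%R (@block R n m p D j) (@block_linear j).

Lemma dot_blocks z w : dot z w = \sum_j dot (block D j z) (block D j w).
Proof.
rewrite /dot (sum_var (xvar_bij D)) (sum_var (yvar_bij D)) -big_split /=.
by apply: eq_bigr => j _; congr (_ + _); apply: eq_bigr => k _; rewrite !mxE.
Qed.

Lemma eq_blocks z w : (forall j, block D j z = block D j w) -> z = w.
Proof.
case: z w => [z1 z2] [w1 w2] zw; congr (_, _); apply/rowP => i.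
  have [j [k <-]] := var_surj (xvar_bij D) i.
  by have [/rowP/(_ k) + _] := zw j; rewrite !mxE.
have [j [k <-]] := var_surj (yvar_bij D) i.
by have [_ /rowP/(_ k)] := zw j; rewrite !mxE.
Qed.

Lemma block_set_block j (u : Eb j) z : block D j (set_block u z) = u.
Proof.
rewrite [RHS]surjective_pairing; congr (_, _); apply/rowP => k; rewrite !mxE.
  by rewrite (pick_var (xvar_bij D)).
by rewrite (pick_var (yvar_bij D)).
Qed.

Lemma block_set_block_neq j j' (u : Eb j) z : j' != j ->
  block D j' (set_block u z) = block D j' z.
Proof.
move=> jj'; congr (_, _); apply/rowP => k; rewrite !mxE.
  by rewrite (pick_var_neq (xvar_bij D)).
by rewrite (pick_var_neq (yvar_bij D)).
Qed.

Lemma block_of_blocks (d : forall j, Eb j) j : block D j (of_blocks d) = d j.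
Proof.
rewrite /of_blocks linear_sum (bigD1 j) //= block_set_block big1 ?addr0//.
by move=> j' jj'; rewrite block_set_block_neq 1?eq_sym// linear0.
Qed.

Lemma set_block_line j (u : Eb j) z (t : R) :
  set_block (t *: u + block D j z) z = t *: set_block u 0 + z.
Proof.
apply: eq_blocks => j'; rewrite linearP /=.
have [->|jj'] := eqVneq j' j; first by rewrite !block_set_block.
by rewrite !block_set_block_neq// linear0 scaler0 add0r.
Qed.

Lemma set_block_block j z : set_block (block D j z) z = z.
Proof.
by have := set_block_line (0 : Eb j) z 0; rewrite !scale0r !add0r.
Qed.

Lemma set_block_deltax j (k : 'I_(xdim D j)) :
  set_block ((delta_mx 0 k, 0) : Eb j) 0 = (delta_mx 0 (xvar k), 0) :> E.
Proof.
congr (_, _); apply/rowP => i; rewrite !mxE /=.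
  case: pickP => [l /eqP <-|/(_ k) ki]; rewrite ?mxE /=.
    by rewrite (inj_eq (@var_inj _ _ _ _ (xvar_bij D) j)).
  by rewrite [i == _]eq_sym ki.
by case: pickP => [l _|//]; rewrite mxE.
Qed.

Lemma set_block_deltay j (k : 'I_(ydim D j)) :
  set_block ((0, delta_mx 0 k) : Eb j) 0 = (0, delta_mx 0 (yvar k)) :> E.
Proof.
congr (_, _); apply/rowP => i; rewrite !mxE /=.
  by case: pickP => [l _|//]; rewrite mxE.
case: pickP => [l /eqP <-|/(_ k) ki]; rewrite ?mxE /=.
  by rewrite (inj_eq (@var_inj _ _ _ _ (yvar_bij D) j)).
by rewrite [i == _]eq_sym ki.
Qed.

(** Moving the block [j] along [u] is moving the whole vector along [u] padded
with zeros: both difference quotients are the same function of the step. *)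
Lemma derive_set_block j h z (u : Eb j) :
  'D_u (fun v : Eb j => h (set_block v z)) (block D j z) =
  'D_(set_block u 0) h z.
Proof.
rewrite /derive.
have -> // : (fun t => t^-1 *: (((fun v : Eb j => h (set_block v z)) \o
    shift (block D j z)) (t *: u) - h (set_block (block D j z) z))) =
  (fun t => t^-1 *: ((h \o shift z) (t *: set_block u 0) - h z)).
by apply/funext => t /=; rewrite set_block_line set_block_block.
Qed.

Lemma block_gradE j h z : block_grad D j h z = block D j (grad h z).
Proof.
congr (_, _); apply/rowP => k; rewrite !mxE derive_set_block.
  by rewrite set_block_deltax.
by rewrite set_block_deltay.
Qed.

Lemma grad_cst_block j h z :
  (forall u v : Eb j, h (set_block u z) = h (set_block v z)) ->
  block D j (grad h z) = 0.
Proof.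
move=> h_cst; rewrite -block_gradE /block_grad.
have -> : (fun u : Eb j => h (set_block u z)) = cst (h z).
  by apply/funext => u; rewrite (h_cst u (block D j z)) set_block_block.
by congr (_, _); apply/rowP => k; rewrite !mxE derive_cst.
Qed.

(** * Splitting the linearized problem into blocks *)

Lemma UCNP_obj_sum rho h z d :
  \sum_j UCNP_obj rho h z (block D j d) =
  dot (grad h z) d + rho / 2 * enorm d ^+ 2.
Proof.
rewrite /UCNP_obj big_split /= -mulr_sumr enorm_sqr !dot_blocks.
congr (_ + _ * _); apply: eq_bigr => j _; first by rewrite block_gradE.
by rewrite enorm_sqr.
Qed.

(** A constraint that depends on the block [j0] only has a gradient supported in
[j0]: its linearization is imposed by the cone of [j0] and is the trivial
inequality [0 <= 0] in the other cones. *)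
Lemma Tcone_blocks r (gs : 'I_r -> E -> R) z d : decomposable D gs ->
  (forall j, Tcone gs z (block D j d)) <-> (forall i, dot (grad (gs i) z) d <= 0).
Proof.
move=> dec_gs.
have dotE i : exists j0, forall j, dot (block_grad D j (gs i) z) (block D j d) =
    if j == j0 then dot (grad (gs i) z) d else 0.
  have [j0 gs_j0] := dec_gs i; exists j0 => j.
  have grad0 j' : j' != j0 -> block D j' (grad (gs i) z) = 0.
    move=> j'j0; apply: grad_cst_block => u v; apply: gs_j0.
    by rewrite !block_set_block_neq // eq_sym.
  rewrite block_gradE; have [->|jj0] := eqVneq j j0; last first.
    by rewrite grad0// dot0l.
  rewrite dot_blocks (bigD1 j0) //= [X in _ + X]big1 ?addr0// => j' j'j0.
  by rewrite grad0// dot0l.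
split=> [Td i|Td j i]; have [j0 E] := dotE i.
  by have := Td j0 i; rewrite E eqxx.
by rewrite E; case: ifP.
Qed.

End Blocks.

(** * Optimality and multipliers *)

Theorem theorem4p2 (R : realType) (n m r p : nat)
    (f : 'rV[R]_n -> R) (g : 'rV[R]_n * 'rV[R]_m -> R)
    (gs : 'I_r -> 'rV[R]_n * 'rV[R]_m -> R) (rho : R)
    (D : decomposition n m p)
    (zs : 'rV[R]_n * 'rV[R]_m)
    (ds : forall j : 'I_p, 'rV[R]_(xdim D j) * 'rV[R]_(ydim D j)) :
  uniform_CN_form rho f g gs ->
  decomposable D gs ->
  Xf f g gs zs ->
  (forall j : 'I_p,
     optimal_solution (UCNP_obj rho g zs) (Tcone gs zs) (ds j)
     /\ 0 <= UCNP_obj rho g zs (ds j)) ->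
  (optimal_solution g (Xg gs) zs /\ optimal_solution f [set: 'rV[R]_n] zs.1)
  /\
  ((exists d' : 'rV[R]_n * 'rV[R]_m,
      forall i : 'I_r, dot (grad (gs i) zs) d' < 0) ->
   exists alpha : 'I_r -> R,
     (forall i : 'I_r, 0 <= alpha i) /\
     rho *: of_blocks ds + grad g zs + \sum_(i < r) alpha i *: grad (gs i) zs
       = 0).
Proof.
move=> [CN [_ g_unif]] dec_gs [zs_feas fzs] ds_opt.
have g_ge z : Xg gs z -> g zs <= g z.
  move=> z_feas; rewrite -(subrKC zs z) -subr_ge0.
  apply: le_trans (g_unif zs (z - zs)).
  rewrite -(UCNP_obj_sum D); apply: sumr_ge0 => j _.
  have [[_ ds_min] ds_ge0] := ds_opt j; apply: (le_trans ds_ge0); apply: ds_min.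
  move: j {ds_ge0}; apply/Tcone_blocks => // i.
  have [gsi_diff _] := CN_cstr_diff CN i.
  have := convex_gradient (z - zs) (CN_cstr_convex CN i) (gsi_diff zs).
  by rewrite subrKC zs_feas z_feas add0r.
split; first split.
- by split.
- split=> // x _; have [y [[y_feas _] ->]] := CN_min CN x.
  by rewrite fzs; exact: g_ge.
move=> _; suff [alpha alpha_ge0 kkt] : exists2 alpha : 'I_r -> R,
    (forall i, 0 <= alpha i) & rho *: of_blocks ds + grad g zs +
      \sum_i alpha i *: grad (gs i) zs = 0 by exists alpha.
apply: cone_quadratic_kkt; split=> [|d d_feas].
  apply/(Tcone_blocks _ _ dec_gs) => j.
  by rewrite block_of_blocks; have [[]] := ds_opt j.
rewrite -!(UCNP_obj_sum D); apply: ler_sum => j _; rewrite block_of_blocks.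
have [[_ ds_min] _] := ds_opt j; apply: ds_min; move: j.
exact/Tcone_blocks.
Qed.
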